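(* Let $N=\langle V,E\rangle$ be a network, $\mathcal M$ a finite set of messages, $\mathcal F$ a forwarding scheme, $1\le \ell\le|\mathcal M|$ a guarantee, and $t\in\mathbb N$ a timeout, with temporary edge crashes and omissions. Let $\mathcal C=\mathcal C[N,\mathcal M,\mathcal F]$ be the associated Markov chain and $F_\ell$ its set of target states. Then the probability that a path of $\mathcal C$, started in the initial state, reaches $F_\ell$ within $t$ rounds (i.e. within its first $2t$ transitions) equals $\mathrm{Score}(\mathcal F)$.
   Context: **Network and messages.** A network is a finite directed graph $N=\langle V,E\rangle$ in which every vertex (switch) $v$ has exactly $d$ outgoing edges, $out(v)$, listed in a fixed order $e_1,\dots,e_d$. Each message $m\in\mathcal M$ has a source $s(m)\in V$ and a target $t(m)\in V$. Time is discrete; $t\in\mathbb N$ is the timeout. **Forwarding scheme.** $\mathcal F=\langle \mathcal A,\{\prec_v\}_{v\in V},\{\prec_m^v\}_{m\in\mathcal M,v\in V}\rangle$, where $\prec_v$ is a strict total order on messages (priorities at $v$), $\prec^v_m$ is a strict total order on $e_1,\dots,e_d$ (preferences of $m$ at $v$), and $\mathcal A$ is a finite set of rules $\varphi\to \mathrm{Forward}(m,e_i)$, with assertions $\varphi ::= m \mid e_i\mid m<m' \mid e_i<_m e_j\mid \varphi\vee\varphi\mid\neg\varphi$ ($m,m'\in\mathcal M$, $1\le i,j\le d$). At a vertex $v$, for a set $M\subseteq \mathcal M$ (messages in $v$'s queue) and a set $T$ of active edges: $(M,T)\models m$ iff $m\in M$; $(M,T)\models e_i$ iff the $i$-th edge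 of $v$ is in $T$; $(M,T)\models m<m'$ iff $m\prec_v m'$; $(M,T)\models e_i<_m e_j$ iff $e_i\prec_m^v e_j$; Boolean connectives as usual. If $(M,T)\models\varphi$ for a rule $\varphi\to\mathrm{Forward}(m,e_i)$, then $m$ is forwarded on the $i$-th edge of $v$. Rules may also use auxiliary, non-circular definitions of named sets of messages or of edges (those satisfying an assertion, closed under union, intersection, difference), with set membership as an atom. The algorithm is required to be legal: at each step at most one message is forwarded on each edge, each message is forwarded on at most one edge, messages are forwarded only on active edges and only from the switch whose queue contains them, and a message is never forwarded from its target. **Outcomes and score.** A configuration assigns each message a vertex. The initial configuration puts each $m$ at $s(m)$. In each of the rounds $1,\dots,t$: a set $T\subseteq E$ of active edges is drawn, each edge $e$ being active independently (of other edges and rounds) with probability $1-p^e_{crash}$; $\mathcal F$ is run at every vertex $v$ with the messages currently at $v$ and $T$; a message that is not forwarded stays; a message forwarded on $e=\langle v,u\rangle$ is omitted with probability $p^e_{omit}$, independently, and then stays at $v$, and otherwise moves to $u$. Here $p^e_{crash},p^e_{omit}\in[0,1]$ are given for each $e\in E$. $\mathrm{Score}(\mathcal F)$ is the probability that at least $\ell$ messages arrive at their targets by time $t$, i.e. within the $t$ rounds. **The Markov chain $\mathcal C$.** Write $\mathcal M=\{m_1,\dots,m_n\}$, and for each vertex $v$ let $\langle v,v\rangle^{\circ}$ be an additional ''stay'' symbol; $\hat E=E\cup\{\langle v,v\rangle^\circ:v\in V\}$. The states are $V^n\cup \hat E^n$; the initial state is $\langle s(m_1),\dots,s(m_n)\rangle$.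 For $\bar v=\langle v_1,\dots,v_n\rangle\in V^n$ and $T\subseteq E$, let $\delta(\bar v,T)\in\hat E^n$ have as $i$-th component the edge of $v_i$ on which $\mathcal F$ forwards $m_i$ at $v_i$ given queue $M=\{m_j:v_j=v_i\}$ and active edges $T$, or $\langle v_i,v_i\rangle^\circ$ if $m_i$ is not forwarded. The transition probability from $\bar v$ to $\bar e\in\hat E^n$ is $\sum_{T:\delta(\bar v,T)=\bar e}\ \prod_{e\in T}(1-p^e_{crash})\prod_{e\in E\setminus T}p^e_{crash}$. From $\bar e\in\hat E^n$, independently over components, a component $e=\langle v,u\rangle\in E$ becomes $u$ with probability $1-p^e_{omit}$ and $v$ with probability $p^e_{omit}$, and a component $\langle v,v\rangle^\circ$ becomes $v$; the result is a state in $V^n$. Finally $F_\ell=\{\langle v_1,\dots,v_n\rangle\in V^n: |\{j:v_j=t(m_j)\}|\ge\ell\}$. *)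

(* Defs.v *)
From mathcomp Require Import all_boot all_order all_algebra.

Set Implicit Arguments.
Unset Strict Implicit.
Unset Printing Implicit Defensive.

Import Order.TTheory GRing.Theory Num.Theory.
Local Open Scope ring_scope.

(** * Networks and messages *)

(* [arcs] is a set of ordered pairs: self-loops are allowed, parallel edges are
   not.  [out v] lists the outgoing edges e_1, ..., e_d of [v]. *)
Record network := Network {
  vertex : finType;
  arcs : {set vertex * vertex};
  degree : nat;
  out : vertex -> degree.-tuple {a : vertex * vertex | a \in arcs};
  out_uniq : forall v, uniq (out v);
  mem_out : forall v a, (a \in out v) = ((val a).1 == v)
}.

Definition edge (N : network) : finType :=
  {a : vertex N * vertex N | a \in arcs N}.
Definition tail (N : network) (e : edge N) : vertex N := (val e).1.
Definition head (N : network) (e : edge N) : vertex N := (val e).2.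
Definition out_edge (N : network) (v : vertex N) (i : 'I_(degree N)) : edge N :=
  tnth (out v) i.

Record messages (N : network) := Messages {
  message :> finType;
  source : message -> vertex N;
  target : message -> vertex N
}.

(** * Forwarding algorithms *)

(* [M] is the type of messages and [d] the number of outgoing edges of a switch;
   message sets and edge sets have separate name spaces. *)
Inductive assertion (M : finType) (d : nat) : Type :=
| Queued of M
| Active of 'I_d
| Precedes of M & M
| Prefers of M & 'I_d & 'I_d
| Or of assertion M d & assertion M d
| Not of assertion M d
| InMsgSet of M & nat
| InEdgeSet of 'I_d & nat.

(* [MsgSat phi] is {m | phi m}: a comprehension is given by one assertion for
   each of the finitely many messages, and likewise for [EdgeSat]. *)
Inductive msg_set (M : finType) (d : nat) : Type :=
| MsgSat of (M -> assertion M d)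
| MsgName of nat
| MsgUnion of msg_set M d & msg_set M d
| MsgInter of msg_set M d & msg_set M d
| MsgDiff of msg_set M d & msg_set M d.

Inductive edge_set (M : finType) (d : nat) : Type :=
| EdgeSat of ('I_d -> assertion M d)
| EdgeName of nat
| EdgeUnion of edge_set M d & edge_set M d
| EdgeInter of edge_set M d & edge_set M d
| EdgeDiff of edge_set M d & edge_set M d.

Inductive definition (M : finType) (d : nat) : Type :=
| DefMsgs of nat & msg_set M d
| DefEdges of nat & edge_set M d.

Record rule (M : finType) (d : nat) := Rule {
  guard : assertion M d;
  rule_msg : M;
  rule_edge : 'I_d
}.

Fixpoint assertion_closed (M : finType) (d : nat) (X Y : seq nat)
    (phi : assertion M d) : bool :=
  match phi with
  | Or a b => assertion_closed X Y a && assertion_closed X Y b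
  | Not a => assertion_closed X Y a
  | InMsgSet _ x => x \in X
  | InEdgeSet _ y => y \in Y
  | _ => true
  end.

Fixpoint msg_set_closed (M : finType) (d : nat) (X Y : seq nat)
    (S : msg_set M d) : bool :=
  match S with
  | MsgSat phi => [forall m, assertion_closed X Y (phi m)]
  | MsgName x => x \in X
  | MsgUnion A B | MsgInter A B | MsgDiff A B =>
      msg_set_closed X Y A && msg_set_closed X Y B
  end.

Fixpoint edge_set_closed (M : finType) (d : nat) (X Y : seq nat)
    (S : edge_set M d) : bool :=
  match S with
  | EdgeSat phi => [forall i, assertion_closed X Y (phi i)]
  | EdgeName y => y \in Y
  | EdgeUnion A B | EdgeInter A B | EdgeDiff A B =>
      edge_set_closed X Y A && edge_set_closed X Y B
  end.

(* Non-circularity: a definition introduces a fresh name and mentions only the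
   names [X] (message sets) and [Y] (edge sets) introduced before it; the rules
   may mention all of them. *)
Fixpoint noncircular (M : finType) (d : nat) (X Y : seq nat)
    (defs : seq (definition M d)) (rules : seq (rule M d)) : bool :=
  match defs with
  | [::] => all (fun r => assertion_closed X Y (guard r)) rules
  | DefMsgs x A :: defs' =>
      [&& x \notin X, msg_set_closed X Y A
        & noncircular (x :: X) Y defs' rules]
  | DefEdges y A :: defs' =>
      [&& y \notin Y, edge_set_closed X Y A
        & noncircular X (y :: Y) defs' rules]
  end.

Record algorithm (M : finType) (d : nat) := Algorithm {
  alg_defs : seq (definition M d);
  alg_rules : seq (rule M d);
  alg_noncircular : noncircular [::] [::] alg_defs alg_rules
}.

Definition strict_total (T : eqType) (r : rel T) : Prop :=
  [/\ irreflexive r, transitive r & forall x y, x != y -> r x y || r y x].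

Record forwarding_scheme (N : network) (M : messages N) := ForwardingScheme {
  scheme_alg : algorithm M (degree N);
  priority : vertex N -> rel M;
  preference : M -> vertex N -> rel 'I_(degree N);
  priorityP : forall v, strict_total (priority v);
  preferenceP : forall m v, strict_total (preference m v)
}.

(** * Semantics of assertions *)

(* The view of an algorithm at one switch: queue, indices of the active outgoing
   edges, priorities, and the preferences of every message. *)
Record local_view (M : finType) (d : nat) := LocalView {
  view_queue : {set M};
  view_active : {set 'I_d};
  view_prio : rel M;
  view_pref : M -> rel 'I_d
}.

Record env (M : finType) (d : nat) := Env {
  env_msgs : nat -> {set M};
  env_edges : nat -> {set 'I_d}
}.

Fixpoint sat (M : finType) (d : nat) (w : local_view M d) (rho : env M d)
    (phi : assertion M d) : bool :=
  match phi with
  | Queued m => m \in view_queue w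
  | Active i => i \in view_active w
  | Precedes m m' => view_prio w m m'
  | Prefers m i j => view_pref w m i j
  | Or a b => sat w rho a || sat w rho b
  | Not a => ~~ sat w rho a
  | InMsgSet m x => m \in env_msgs rho x
  | InEdgeSet i y => i \in env_edges rho y
  end.

Fixpoint eval_msg_set (M : finType) (d : nat) (w : local_view M d)
    (rho : env M d) (S : msg_set M d) : {set M} :=
  match S with
  | MsgSat phi => [set m | sat w rho (phi m)]
  | MsgName x => env_msgs rho x
  | MsgUnion A B => eval_msg_set w rho A :|: eval_msg_set w rho B
  | MsgInter A B => eval_msg_set w rho A :&: eval_msg_set w rho B
  | MsgDiff A B => eval_msg_set w rho A :\: eval_msg_set w rho B
  end.

Fixpoint eval_edge_set (M : finType) (d : nat) (w : local_view M d)
    (rho : env M d) (S : edge_set M d) : {set 'I_d} :=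
  match S with
  | EdgeSat phi => [set i | sat w rho (phi i)]
  | EdgeName y => env_edges rho y
  | EdgeUnion A B => eval_edge_set w rho A :|: eval_edge_set w rho B
  | EdgeInter A B => eval_edge_set w rho A :&: eval_edge_set w rho B
  | EdgeDiff A B => eval_edge_set w rho A :\: eval_edge_set w rho B
  end.

Definition eval_def (M : finType) (d : nat) (w : local_view M d)
    (rho : env M d) (D : definition M d) : env M d :=
  match D with
  | DefMsgs x A =>
      Env [eta env_msgs rho with x |-> eval_msg_set w rho A] (env_edges rho)
  | DefEdges y A =>
      Env (env_msgs rho) [eta env_edges rho with y |-> eval_edge_set w rho A]
  end.

(* The empty initial environment is never consulted, by non-circularity. *)
Definition alg_env (M : finType) (d : nat) (A : algorithm M d)
    (w : local_view M d) : env M d :=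
  foldl (eval_def w) (Env (fun=> set0) (fun=> set0)) (alg_defs A).

Definition alg_forwards (M : finType) (d : nat) (A : algorithm M d)
    (w : local_view M d) (m : M) (i : 'I_d) : bool :=
  has (fun r => [&& rule_msg r == m, rule_edge r == i
                  & sat w (alg_env A w) (guard r)]) (alg_rules A).

(** * Configurations and legality *)

Definition config (N : network) (M : messages N) : finType :=
  {ffun M -> vertex N}.

Definition init_config (N : network) (M : messages N) : config M :=
  [ffun m => source m].

Definition view_at (N : network) (M : messages N) (F : forwarding_scheme M)
    (c : config M) (T : {set edge N}) (v : vertex N) :
    local_view M (degree N) :=
  LocalView [set m | c m == v] [set i | out_edge v i \in T]
    (priority F v) (fun m => preference F m v).

(* With the messages placed as in [c] and active edges [T], running the scheme
   at [v] forwards [m] on the [i]-th edge of [v]. *)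
Definition forwards (N : network) (M : messages N) (F : forwarding_scheme M)
    (c : config M) (T : {set edge N}) (v : vertex N) (m : M)
    (i : 'I_(degree N)) : bool :=
  alg_forwards (scheme_alg F) (view_at F c T v) m i.

Record legal (N : network) (M : messages N) (F : forwarding_scheme M) : Prop :=
  Legal {
    legal_edge : forall c T v m m' i,
      forwards F c T v m i -> forwards F c T v m' i -> m = m';
    legal_msg : forall c T v v' m i j,
      forwards F c T v m i -> forwards F c T v' m j ->
      out_edge v i = out_edge v' j;
    legal_active : forall c T v m i,
      forwards F c T v m i -> out_edge v i \in T;
    legal_queue : forall c T v m i, forwards F c T v m i -> c m = v;
    legal_target : forall c T v m i, forwards F c T v m i -> v <> target m
  }.

(* The edge on which [m] is forwarded from its current switch, if any; it is
   unique for legal schemes. *)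
Definition forwarded_on (N : network) (M : messages N) (F : forwarding_scheme M)
    (c : config M) (T : {set edge N}) (m : M) : option (edge N) :=
  omap (out_edge (c m)) [pick i | forwards F c T (c m) m i].

(** * Faults and the score *)

Record faults (R : realFieldType) (N : network) := Faults {
  crash : edge N -> R;
  omission : edge N -> R;
  crash01 : forall e, 0 <= crash e <= 1;
  omission01 : forall e, 0 <= omission e <= 1
}.

Definition active_prob (R : realFieldType) (N : network) (p : faults R N)
    (T : {set edge N}) : R :=
  (\prod_(e in T) (1 - crash p e)) * (\prod_(e in ~: T) crash p e).

(* The random choices of one round: the set of active edges, and the set of
   pairs (m, e) such that [m] is omitted if it is forwarded on [e].  The coins
   of all pairs are independent, and the coin of (m, e) is consulted only if [m]
   is indeed forwarded on [e]. *)
Definition round (N : network) (M : messages N) : finType :=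
  ({set edge N} * {set M * edge N})%type.

Definition omission_prob (R : realFieldType) (N : network) (M : messages N)
    (p : faults R N) (O : {set M * edge N}) : R :=
  (\prod_(x in O) omission p x.2) * (\prod_(x in ~: O) (1 - omission p x.2)).

Definition round_prob (R : realFieldType) (N : network) (M : messages N)
    (p : faults R N) (r : round M) : R :=
  active_prob p r.1 * omission_prob p r.2.

Definition step (N : network) (M : messages N) (F : forwarding_scheme M)
    (c : config M) (r : round M) : config M :=
  [ffun m => if forwarded_on F c r.1 m is Some e then
               if (m, e) \in r.2 then c m else head e
             else c m].

Definition config_after (N : network) (M : messages N)
    (F : forwarding_scheme M) (w : seq (round M)) (k : nat) : config M :=
  foldl (step F) (init_config M) (take k w).

Definition arrived (N : network) (M : messages N) (F : forwarding_scheme M)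
    (t : nat) (w : t.-tuple (round M)) : {set M} :=
  [set m | [exists k : 'I_t.+1, config_after F w k m == target m]].

Definition score (R : realFieldType) (N : network) (M : messages N)
    (F : forwarding_scheme M) (p : faults R N) (l t : nat) : R :=
  \sum_(w : t.-tuple (round M) | (l <= #|arrived F w|)%N)
    \prod_(r <- w) round_prob p r.

(** * Finite Markov chains *)

Record markov_chain (R : realFieldType) := MarkovChain {
  state : finType;
  init_state : state;
  trans : state -> state -> R;
  trans_ge0 : forall x y, 0 <= trans x y;
  trans_sum1 : forall x, \sum_y trans x y = 1
}.

(* Probability that a path from the initial state visits [A] within its first
   [k] transitions (the initial state counts). *)
Definition reach_prob (R : realFieldType) (C : markov_chain R) (k : nat)
    (A : {set state C}) : R :=
  \sum_(x : k.-tuple (state C) | has [in A] (init_state C :: x))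
    \prod_(q <- pairmap (@trans R C) (init_state C) x) q.

(** * The chain of a forwarding scheme *)

(* [inr v] is the symbol for staying at [v]. *)
Definition hat_edge (N : network) : finType := (edge N + vertex N)%type.

Definition chain_state (N : network) (M : messages N) : finType :=
  (config M + {ffun M -> hat_edge N})%type.

Definition delta (N : network) (M : messages N) (F : forwarding_scheme M)
    (c : config M) (T : {set edge N}) : {ffun M -> hat_edge N} :=
  [ffun m => if forwarded_on F c T m is Some e then inl e else inr (c m)].

(* The two summands for [inl e] add up when [e] is a self-loop. *)
Definition move_prob (R : realFieldType) (N : network) (p : faults R N)
    (x : hat_edge N) (v : vertex N) : R :=
  match x with
  | inl e => (v == head e)%:R * (1 - omission p e)
             + (v == tail e)%:R * omission p e
  | inr u => (v == u)%:R
  end.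

Definition chain_trans (R : realFieldType) (N : network) (M : messages N)
    (F : forwarding_scheme M) (p : faults R N) (x y : chain_state M) : R :=
  match x, y with
  | inl c, inr f => \sum_(T : {set edge N} | delta F c T == f) active_prob p T
  | inr f, inl c => \prod_(m : M) move_prob p (f m) (c m)
  | _, _ => 0
  end.

Lemma active_prob_ge0 (R : realFieldType) (N : network) (p : faults R N)
    (T : {set edge N}) : 0 <= active_prob p T.
Proof.
apply: mulr_ge0; apply: prodr_ge0 => e _; have /andP[] := crash01 p e => //.
by rewrite subr_ge0.
Qed.

Lemma active_prob_sum1 (R : realFieldType) (N : network) (p : faults R N) :
  \sum_(T : {set edge N}) active_prob p T = 1.
Proof.
transitivity (\prod_(e : edge N) ((1 - crash p e) + crash p e)).
  rewrite bigA_distr; apply: eq_bigr => T _.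
  rewrite [RHS](bigID [in T]) /=; congr (_ * _).
    by apply: eq_bigr => e ->.
  by apply: eq_big => e; rewrite inE // => /negPf->.
by apply: big1 => e _; rewrite subrK.
Qed.

Lemma move_prob_ge0 (R : realFieldType) (N : network) (p : faults R N)
    (x : hat_edge N) (v : vertex N) : 0 <= move_prob p x v.
Proof.
case: x => [e|u] /=; last exact: ler0n.
have /andP[h0 h1] := omission01 p e.
by apply: addr_ge0; apply: mulr_ge0; rewrite ?ler0n ?subr_ge0.
Qed.

Lemma move_prob_sum1 (R : realFieldType) (N : network) (p : faults R N)
    (x : hat_edge N) : \sum_v move_prob p x v = 1.
Proof.
have one (u : vertex N) : \sum_(v : vertex N) (v == u)%:R = 1 :> R.
  by rewrite (bigD1 u) //= eqxx big1 ?addr0 // => v /negPf->.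
case: x => [e|u] //=.
by rewrite big_split -!mulr_suml /= !one !mul1r subrK.
Qed.

Lemma chain_trans_ge0 (R : realFieldType) (N : network) (M : messages N)
    (F : forwarding_scheme M) (p : faults R N) (x y : chain_state M) :
  0 <= chain_trans F p x y.
Proof.
case: x y => [c|f] [c'|f'] //=.
  by apply: sumr_ge0 => T _; apply: active_prob_ge0.
by apply: prodr_ge0 => m _; apply: move_prob_ge0.
Qed.

Lemma chain_trans_sum1 (R : realFieldType) (N : network) (M : messages N)
    (F : forwarding_scheme M) (p : faults R N) (x : chain_state M) :
  \sum_y chain_trans F p x y = 1.
Proof.
rewrite big_sumType; case: x => [c|f] /=.
  rewrite big1 // add0r -(active_prob_sum1 p).
  by rewrite (partition_big (delta F c) xpredT).
rewrite [X in _ + X]big1 // addr0 -(bigA_distr_bigA (fun m => move_prob p (f m))).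
by apply: big1 => m _; apply: move_prob_sum1.
Qed.

Definition chain (R : realFieldType) (N : network) (M : messages N)
    (F : forwarding_scheme M) (p : faults R N) : markov_chain R :=
  MarkovChain (inl (init_config M)) (chain_trans_ge0 F p)
    (chain_trans_sum1 F p).

Definition target_states (N : network) (M : messages N) (l : nat) :
    {set chain_state M} :=
  [set x : chain_state M |
    if x is inl c then (l <= #|[set m | c m == target m]|)%N else false].

(* Main.v *)
Require Import Defs.
From mathcomp Require Import all_boot all_order all_algebra.
Local Open Scope ring_scope.

Set Implicit Arguments.
Unset Strict Implicit.
Unset Printing Implicit Defensive.

Import GRing.Theory.

(** Two transitions of the chain have the same law as one round: given the set of
    active edges, only the coin of the pair (message, edge it is forwarded on)
    matters for each message, so the omission coins factor over messages.  A
    legal scheme never forwards a message from its target, hence arrived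
    messages stay put, and "at least [l] messages have arrived" is an absorbing
    event determined by the current configuration.  Both sides of the claim then
    satisfy the same first-step recursion. *)

(** [P] and [f] live on plain sequences, so the same [P] and [f] apply to [w] and to [x :: w]
    without casts between tuple lengths. *)
Lemma big_tupleS (R : nmodType) (T : finType) (k : nat) (P : pred (seq T))
    (f : seq T -> R) :
  \sum_(w : k.+1.-tuple T | P w) f w =
  \sum_x \sum_(w : k.-tuple T | P (x :: w)) f (x :: w).
Proof.
rewrite pair_big_dep /=.
rewrite (reindex (fun q : T * k.-tuple T => [tuple of q.1 :: q.2])) //=.
exists (fun w : k.+1.-tuple T => (thead w, behead_tuple w)) => [[x w] _|w _].
  by congr (_, _); apply/val_inj.
by rewrite [RHS]tuple_eta.
Qed.

Lemma big_tuple0 (R : nmodType) (T : finType) (P : pred (seq T))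
    (f : seq T -> R) :
  \sum_(w : 0.-tuple T | P w) f w = if P [::] then f [::] else 0.
Proof.
rewrite big_mkcond /= (eq_bigr (fun=> if P [::] then f [::] else 0)).
  by rewrite sumr_const card_tuple expn0.
by move=> w _; rewrite tuple0.
Qed.

(** [reach_prob] with an arbitrary starting state, as first-step recursion requires. *)
Definition hit_prob (R : realFieldType) (C : markov_chain R)
    (A : {set state C}) (k : nat) (x : state C) : R :=
  \sum_(w : k.-tuple (state C) | has [in A] (x :: w))
    \prod_(q <- pairmap (@trans R C) x w) q.

Section HitProb.
Variables (R : realFieldType) (C : markov_chain R) (A : {set state C}).

Lemma path_prob_sum1 (k : nat) (x : state C) :
  \sum_(w : k.-tuple (state C)) \prod_(q <- pairmap (@trans R C) x w) q = 1.
Proof.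
elim: k x => [|k IHk] x.
  by rewrite (@big_tuple0 _ _ xpredT
    (fun w => \prod_(q <- pairmap (@trans R C) x w) q)) big_nil.
rewrite (@big_tupleS _ _ _ xpredT
  (fun w => \prod_(q <- pairmap (@trans R C) x w) q)) -[RHS](trans_sum1 x).
apply: eq_bigr => y _ /=.
by under eq_bigr do rewrite big_cons; rewrite -mulr_sumr IHk mulr1.
Qed.

Lemma hit_prob_in (k : nat) (x : state C) : x \in A -> hit_prob A k x = 1.
Proof.
move=> Ax; rewrite /hit_prob -[RHS](path_prob_sum1 k x).
by apply: eq_bigl => w /=; rewrite Ax.
Qed.

Lemma hit_prob0 (x : state C) : x \notin A -> hit_prob A 0 x = 0.
Proof.
move=> /negPf Ax; rewrite /hit_prob.
by rewrite (@big_tuple0 _ _ (fun w => has [in A] (x :: w))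
  (fun w => \prod_(q <- pairmap (@trans R C) x w) q)) /= Ax.
Qed.

(** Since [x] itself is no visit to [A], the visit must happen on the path that starts at the next
    state [y]. *)
Lemma hit_probS (k : nat) (x : state C) : x \notin A ->
  hit_prob A k.+1 x = \sum_y trans x y * hit_prob A k y.
Proof.
move=> /negPf Ax; rewrite /hit_prob.
rewrite (@big_tupleS _ _ _ (fun w => has [in A] (x :: w))
  (fun w => \prod_(q <- pairmap (@trans R C) x w) q)).
apply: eq_bigr => y _; rewrite mulr_sumr.
by apply: eq_big => [w|w _] /=; rewrite ?Ax // big_cons.
Qed.

End HitProb.

Section Rounds.
Variables (R : realFieldType) (N : network) (M : messages N).
Variables (F : forwarding_scheme M) (p : faults R N).

Lemma tail_forwarded_on (c : config M) (T : {set edge N}) (m : M) (e : edge N) :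
  forwarded_on F c T m = Some e -> tail e = c m.
Proof.
rewrite /forwarded_on; case: pickP => //= i _ [<-].
by apply/eqP; rewrite /tail -mem_out mem_tnth.
Qed.

(** The event on the left is a conjunction of conditions each involving at most one coin, so its
    probability is a product over messages; coins that are not consulted contribute a factor 1. *)
Lemma omission_step (c c' : config M) (T : {set edge N}) :
  \sum_(O : {set M * edge N} | step F c (T, O) == c') omission_prob p O =
  \prod_m move_prob p (delta F c T m) (c' m).
Proof.
(* [dest m e b]: the value [b] of the coin of [(m, e)] does not prevent [m] from ending at [c' m].
   It is vacuous when [m] is not forwarded on [e]; messages that are not forwarded at all are left
   to [stay]. *)
pose dest (m : M) e (b : bool) : bool :=
  if forwarded_on F c T m is Some e' then
    (e' == e) ==> ((if b then c m else Defs.head e) == c' m)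
  else true.
pose stay (m : M) : R :=
  if forwarded_on F c T m is Some _ then 1 else (c m == c' m)%:R.
pose coin (b : bool) (x : M * edge N) : R :=
  (if b then omission p x.2 else 1 - omission p x.2) * (dest x.1 x.2 b)%:R.
transitivity (\sum_(O : {set M * edge N})
    (\prod_m stay m) * \prod_x (if x \in O then coin true x else coin false x)).
  rewrite big_mkcond; apply: eq_bigr => O _.
  have -> : \prod_x (if x \in O then coin true x else coin false x) =
      omission_prob p O * \prod_x (dest x.1 x.2 (x \in O))%:R.
    transitivity (\prod_x ((if x \in O then omission p x.2
        else 1 - omission p x.2) * (dest x.1 x.2 (x \in O))%:R)).
      by apply: eq_bigr => x _; case: ifP.
    rewrite big_split /=; congr (_ * _).
    rewrite [LHS](bigID [in O]) /=; congr (_ * _).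
      by apply: eq_bigr => x ->.
    by apply: eq_big => x; rewrite ?inE // => /negPf->.
  rewrite mulrCA.
  have -> : \prod_(x : M * edge N) (dest x.1 x.2 (x \in O))%:R =
      \prod_m \prod_e (dest m e ((m, e) \in O))%:R :> R.
    by rewrite pair_bigA; apply: eq_bigr => -[].
  rewrite -big_split /=.
  have -> : \prod_m (stay m * \prod_e (dest m e ((m, e) \in O))%:R) =
      \prod_m (step F c (T, O) m == c' m)%:R :> R.
    apply: eq_bigr => m _; rewrite /stay /dest ffunE.
    case: (forwarded_on F c T m) => [e|] /=; last by rewrite big1 ?mulr1.
    rewrite mul1r (bigD1 e) //= eqxx big1 ?mulr1 // => e'.
    by rewrite eq_sym => /negPf->.
  (* The product of indicators is the indicator of [step F c (T, O) = c']: one wrong component makes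
     it vanish. *)
  case: eqP => [<-|neq]; first by rewrite big1 ?mulr1 // => m _; rewrite eqxx.
  have [m neqm] : exists m, step F c (T, O) m != c' m.
    apply/existsP; rewrite -negb_forall; apply/negP => /forallP eqm.
    by apply: neq; apply/ffunP => m; apply/eqP.
  by rewrite (bigD1 m) //= (negPf neqm) mul0r mulr0.
(* Distributivity, read backwards: the sum over coin sets [O] becomes a product over pairs of the
   sum over both values of one coin. *)
rewrite -mulr_sumr -bigA_distr.
have -> : \prod_x (coin true x + coin false x) =
    \prod_m \prod_e (coin true (m, e) + coin false (m, e)).
  by rewrite pair_bigA; apply: eq_bigr => -[].
rewrite -big_split /=; apply: eq_bigr => m _.
rewrite /stay /coin /dest ffunE /=.
case fwd: (forwarded_on F c T m) => [e|] /=.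
  (* Only the pair [(m, e)] is constrained; for every other edge the two coin values sum to 1. *)
  rewrite mul1r (bigD1 e) //= eqxx big1 /= => [|e' /negPf ne'e].
    rewrite mulr1 (tail_forwarded_on fwd) addrC ![_ == c' m]eq_sym.
    by rewrite [X in X + _]mulrC [X in _ + X]mulrC.
  by rewrite eq_sym ne'e !mulr1 addrC subrK.
by rewrite big1 ?mulr1 1?eq_sym // => e _; rewrite !mulr1 addrC subrK.
Qed.

(** Equality in law, stated against a test function [g]: group the coin sets by the resulting
    configuration, then the active sets by their value under [delta]. *)
Lemma round_transition (c : config M) (g : config M -> R) :
  \sum_(r : round M) round_prob p r * g (step F c r) =
  \sum_f chain_trans F p (inl c) (inr f) *
    \sum_c' chain_trans F p (inr f) (inl c') * g c'.
Proof.
transitivity (\sum_T active_prob p T *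
    \sum_(c' : config M) (\prod_m move_prob p (delta F c T m) (c' m)) * g c').
  transitivity (\sum_T \sum_O round_prob p (T, O) * g (step F c (T, O))).
    by rewrite pair_bigA; apply: eq_bigr => -[].
  apply: eq_bigr => T _; rewrite /round_prob /=.
  under eq_bigr do rewrite -mulrA.
  rewrite -mulr_sumr; congr (_ * _).
  rewrite (partition_big (fun O => step F c (T, O)) xpredT) //=.
  apply: eq_bigr => c' _; rewrite -omission_step mulr_suml.
  by apply: eq_bigr => O /eqP->.
rewrite (partition_big (delta F c) xpredT) //=.
apply: eq_bigr => f _; rewrite mulr_suml.
by apply: eq_bigr => T /eqP->.
Qed.

Definition success (l : nat) (c : config M) : bool :=
  (l <= #|[set m | c m == target m]|)%N.

(** The score from an arbitrary start, judged by the last configuration only; [arrivedE] justifies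
    this for legal schemes. *)
Definition success_prob (l t : nat) (c : config M) : R :=
  \sum_(w : t.-tuple (round M) | success l (foldl (step F) c w))
    \prod_(r <- w) round_prob p r.

Lemma success_prob0 (l : nat) (c : config M) :
  success_prob l 0 c = (success l c)%:R.
Proof.
rewrite /success_prob (@big_tuple0 _ _
  (fun w => success l (foldl (step F) c w))
  (fun w => \prod_(r <- w) round_prob p r)) /= big_nil.
by case: success.
Qed.

Lemma success_probS (l t : nat) (c : config M) :
  success_prob l t.+1 c =
  \sum_(r : round M) round_prob p r * success_prob l t (step F c r).
Proof.
rewrite /success_prob (@big_tupleS _ _ _
  (fun w => success l (foldl (step F) c w))
  (fun w => \prod_(r <- w) round_prob p r)).
apply: eq_bigr => r _; rewrite mulr_sumr.
by apply: eq_bigr => w _; rewrite big_cons.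
Qed.

Lemma sum_chain_inl (c : config M) (g : chain_state M -> R) :
  \sum_y chain_trans F p (inl c) y * g y =
  \sum_f chain_trans F p (inl c) (inr f) * g (inr f).
Proof. by rewrite big_sumType /= big1 ?add0r // => c' _; rewrite mul0r. Qed.

Lemma sum_chain_inr (f : {ffun M -> hat_edge N}) (g : chain_state M -> R) :
  \sum_y chain_trans F p (inr f) y * g y =
  \sum_c chain_trans F p (inr f) (inl c) * g (inl c).
Proof.
by rewrite big_sumType /= addrC big1 ?add0r // => f' _; rewrite mul0r.
Qed.

(** Total mass carries over from the chain, by [round_transition] with the constant test function
    1. *)
Lemma round_prob_sum1 : \sum_(r : round M) round_prob p r = 1.
Proof.
have := round_transition (init_config M) (fun=> 1).
under eq_bigr do rewrite mulr1.
move=> ->; rewrite -[RHS](chain_trans_sum1 F p (inl (init_config M))).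
under [RHS]eq_bigr do rewrite -[chain_trans _ _ _ _]mulr1.
rewrite (sum_chain_inl _ (fun=> 1)); apply: eq_bigr => f _.
rewrite -(sum_chain_inr _ (fun=> 1)); congr (_ * _).
by under eq_bigr do rewrite mulr1; apply: chain_trans_sum1.
Qed.

Hypothesis legalF : legal F.

Lemma step_target (c : config M) (r : round M) (m : M) :
  c m = target m -> step F c r m = target m.
Proof.
move=> cm; rewrite ffunE /forwarded_on; case: pickP => //= i fwd.
by case: (legal_target legalF fwd).
Qed.

Lemma foldl_step_target (c : config M) (w : seq (round M)) (m : M) :
  c m = target m -> foldl (step F) c w m = target m.
Proof. by elim: w c => //= r w IHw c cm; apply/IHw/step_target. Qed.

Lemma success_step (l : nat) (c : config M) (r : round M) :
  success l c -> success l (step F c r).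
Proof.
move=> /leq_trans; apply; apply: subset_leq_card; apply/subsetP => m.
by rewrite !inE => /eqP/step_target->.
Qed.

Lemma success_prob_in (l t : nat) (c : config M) :
  success l c -> success_prob l t c = 1.
Proof.
elim: t c => [|t IHt] c sc; first by rewrite success_prob0 sc.
rewrite success_probS -[RHS]round_prob_sum1; apply: eq_bigr => r _.
by rewrite IHt ?mulr1 //; apply: success_step.
Qed.

Lemma arrivedE (t : nat) (w : t.-tuple (round M)) :
  arrived F w = [set m | foldl (step F) (init_config M) w m == target m].
Proof.
apply/setP => m; rewrite !inE; apply/existsP/eqP => [[k /eqP at_k]|at_t].
  by rewrite -(cat_take_drop k w) foldl_cat; apply: foldl_step_target.
(* The witness is time [t], where the prefix is all of [w]. *)
by exists ord_max; rewrite /config_after take_oversize ?size_tuple // at_t.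
Qed.

Lemma hit_prob_chain (l t : nat) (c : config M) :
  hit_prob (C := chain F p) (target_states M l) (2 * t) (inl c) =
  success_prob l t c.
Proof.
elim: t c => [|t IHt] c; (have [sc|nsc] := boolP (success l c);
  first by rewrite success_prob_in // hit_prob_in // inE).
  by rewrite success_prob0 (negPf nsc) muln0 hit_prob0 // inE.
(* [2 * t.+1] is [2 + 2 * t]: two chain steps are peeled off. The intermediate state [inr f] is
   never a target, so [hit_probS] applies to it as well. *)
rewrite mulnS hit_probS ?inE //= sum_chain_inl success_probS round_transition.
apply: eq_bigr => f _; rewrite hit_probS ?inE //= sum_chain_inr.
by congr (_ * _); apply: eq_bigr => c' _; rewrite IHt.
Qed.

End Rounds.

Theorem theorem1 (R : realFieldType) (N : network) (M : messages N)
    (F : forwarding_scheme M) (legalF : legal F) (p : faults R N)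
    (l t : nat) (l_ge1 : (1 <= l)%N) (l_le : (l <= #|M|)%N) :
  reach_prob (C := chain F p) (2 * t) (target_states M l) = score F p l t.
Proof.
transitivity (success_prob F p l t (init_config M)).
  by rewrite -hit_prob_chain.
by apply: eq_bigl => w; rewrite arrivedE.
Qed.
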